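(* For every sufficiently large $C$ there exist $c,c_2>0$ such that the following holds for all integers $k\ge C^8$. Let $d=c\log k$ and let $\mathcal{D}$ be the distribution over standard mixtures of $k$ spherical Gaussians in $\mathbb{R}^d$ obtained by picking each of the $k$ means independently and uniformly from the Euclidean ball of radius $\sqrt d$ around the origin. Let $\{\mu_1,\dots,\mu_k\}$ be a mixture drawn from $\mathcal{D}$, with p.d.f. $f$. Then with probability at least $1-2/k$ there exists another standard mixture of $k$ spherical Gaussians with means $\{\tilde\mu_1,\dots,\tilde\mu_k\}$ and p.d.f. $\tilde f$ such that: both mixtures are $\sqrt d$-bounded (all means have Euclidean norm at most $\sqrt d$); both are well separated, i.e. $\|\mu_i-\mu_j\|_2\ge c_2\sqrt{\log k}$ and $\|\tilde\mu_i-\tilde\mu_j\|_2\ge c_2\sqrt{\log k}$ for all $i\ne j$; $\|f-\tilde f\|_1\le k^{-C}$; and yet their parameter distance is at least $c_2\sqrt{\log k}$. Moreover, one can take $c=1/(4\log C)$ and $c_2=C^{-24}$.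
   Context: For $\mu\in\mathbb{R}^d$, $\sigma>0$, $g_{\mu,\sigma}(x)=\sigma^{-d}\exp(-\pi\|x-\mu\|_2^2/\sigma^2)$ is the p.d.f. of the spherical Gaussian with mean $\mu$ and covariance $\tfrac{\sigma^2}{2\pi}I$. A standard mixture of $k$ spherical Gaussians with means $\mu_1,\dots,\mu_k\in\mathbb{R}^d$ has p.d.f. $f(x)=\frac1k\sum_{j=1}^k g_{\mu_j,1}(x)$. The parameter distance between standard mixtures with means $(\mu_1,\dots,\mu_k)$ and $(\mu'_1,\dots,\mu'_k)$ is $\min_{\pi}\sum_{j=1}^k\|\mu_j-\mu'_{\pi(j)}\|_2$, the minimum over permutations $\pi$ of $[k]$. *)

(* Defs.v *)
(* Points of R^n are n-tuples of reals, because n.-tuple R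
   carries the product sigma-algebra in the library ('rV[R]_n does not). *)
From HB Require Import structures.
From mathcomp Require Import all_boot all_order all_algebra.
From mathcomp Require Import fingroup perm.
From mathcomp Require Import all_classical all_reals all_analysis.
From mathcomp Require Import measurable_realfun.

Set Implicit Arguments.
Unset Strict Implicit.
Unset Printing Implicit Defensive.

Import Order.TTheory GRing.Theory Num.Theory.
Import numFieldNormedType.Exports.
Local Open Scope classical_set_scope.
Local Open Scope ring_scope.

(* The n-fold power of a sigma-finite measure m, as a measure on n.-tuple T:
   the point mass at the empty tuple for n = 0, and the image of m \x m^n under
   (x, t) |-> x :: t for n + 1. *)
Section power_measure.
Context {dsp : measure_display} {T : measurableType dsp} {R : realType}.

Definition tuple_cons n (p : T * n.-tuple T) : n.+1.-tuple T :=
  [tuple of p.1 :: p.2].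

Lemma measurable_tuple_cons n : measurable_fun setT (@tuple_cons n).
Proof. exact: measurable_cons. Qed.

Lemma measurable_tuple_uncons n :
  measurable_fun setT (fun t : n.+1.-tuple T => (thead t, [tuple of behead t])).
Proof.
apply/measurable_fun_pairP; split => /=; first exact: measurable_tnth.
exact: measurable_behead.
Qed.

Section step.
Variables (n : nat) (m1 : {sigma_finite_measure set T -> \bar R})
  (m2 : {sigma_finite_measure set (n.-tuple T) -> \bar R}).

Definition cons_measure : set (n.+1.-tuple T) -> \bar R :=
  pushforward (m1 \x m2)%E (@tuple_cons n).

Let cons_measure0 : cons_measure set0 = 0%E.
Proof. by rewrite /cons_measure /pushforward preimage_set0 measure0. Qed.

Let cons_measure_ge0 A : (0 <= cons_measure A)%E.
Proof. by rewrite /cons_measure /pushforward measure_ge0. Qed.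

Let cons_measure_sigma_additive : semi_sigma_additive cons_measure.
Proof.
have mc A : measurable A -> measurable (@tuple_cons n @^-1` A).
  by move=> mA; rewrite -[X in measurable X]setTI; exact: measurable_tuple_cons.
move=> F mF tF mUF; rewrite /cons_measure /pushforward preimage_bigcup.
apply: measure_semi_sigma_additive.
- by move=> i; exact: mc.
- apply/trivIsetP => /= i j _ _ ij; rewrite -preimage_setI.
  by move/trivIsetP : tF => /(_ _ _ _ _ ij) ->//; rewrite preimage_set0.
- by rewrite -preimage_bigcup; exact: mc.
Qed.

HB.instance Definition _ := isMeasure.Build _ _ _ cons_measure
  cons_measure0 cons_measure_ge0 cons_measure_sigma_additive.

Let cons_measure_sigma_finite : sigma_finite setT cons_measure.
Proof.
have /sigma_finiteP[F [TF ndF Foo]] := sigma_finiteT m1.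
have /sigma_finiteP[G [TG ndG Goo]] := sigma_finiteT m2.
pose uncons (t : n.+1.-tuple T) := (thead t, [tuple of behead t]).
exists (fun i => uncons @^-1` (F i `*` G i)).
  rewrite -preimage_bigcup; apply/esym; rewrite -subTset => t _ /=.
  have [i _ Fi] : (\bigcup_i F i) (uncons t).1 by rewrite -TF.
  have [j _ Gj] : (\bigcup_i G i) (uncons t).2 by rewrite -TG.
  exists (maxn i j) => //; split.
    by move: Fi; exact/subsetPset/ndF/leq_maxl.
  by move: Gj; exact/subsetPset/ndG/leq_maxr.
move=> i; have [mFi Fioo] := Foo i; have [mGi Gioo] := Goo i; split.
  rewrite -[X in measurable X]setTI; apply: measurable_tuple_uncons => //.
  exact: measurableX.
rewrite /cons_measure /pushforward -comp_preimage.
rewrite [X in X @^-1` _](_ : _ = id) ?preimage_id.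
  by rewrite product_measure1E// lte_mul_pinfty// ge0_fin_numE.
by apply/funext => -[x t] /=; congr pair; exact/val_inj.
Qed.

HB.instance Definition _ := Measure_isSigmaFinite.Build _ _ _ cons_measure
  cons_measure_sigma_finite.

End step.

Fixpoint power_measure (m : {sigma_finite_measure set T -> \bar R}) (n : nat) :
    {sigma_finite_measure set (n.-tuple T) -> \bar R} :=
  if n is n'.+1 then cons_measure m (power_measure m n')
  else \d_([tuple] : 0.-tuple T).

(* This characterizes power_measure as a product measure. *)
Lemma power_measure_box (m : {sigma_finite_measure set T -> \bar R}) n
    (A : 'I_n -> set T) : (forall i, measurable (A i)) ->
  power_measure m n [set t | forall i, A i (tnth t i)] =
  (\prod_(i < n) m (A i))%E.
Proof.
elim: n A => [|n IHn] A mA.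
  by rewrite big_ord0 /= diracE mem_set// => -[].
rewrite big_ord_recl -IHn//= /cons_measure /pushforward.
rewrite (_ : _ @^-1` _ = A ord0 `*`
    [set t | forall i, A (lift ord0 i) (tnth t i)]); last first.
  apply/seteqP; split=> -[x t] /=.
    by move=> h; split=> [|i]; [exact: (h ord0)|have := h (lift ord0 i);
      rewrite tnthS].
  by move=> [h0 h] i; case: (unliftP ord0 i) => [j ->|->]; rewrite ?tnthS.
rewrite product_measure1E//.
rewrite (_ : [set _ | _] = \bigcap_(i in [set: 'I_n])
    ((fun t : n.-tuple T => tnth t i) @^-1` A (lift ord0 i))); last first.
  by apply/seteqP; split=> t /= h; [move=> i _; exact: h|move=> i; exact: h].
apply: fin_bigcap_measurable => // i _.
by rewrite -[X in measurable X]setTI; exact: measurable_tnth.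
Qed.

End power_measure.

Section euclidean.
Variables (R : realType) (n : nat).
Local Notation Rn := (n.-tuple (measurableTypeR R)).
Implicit Types x y : Rn.

Definition euclid_norm x : R := Num.sqrt (\sum_(i < n) tnth x i ^+ 2).

Definition euclid_dist x y : R :=
  euclid_norm [tuple tnth x i - tnth y i | i < n].

Definition euclid_ball (r : R) : set Rn := [set x | euclid_norm x <= r].

Lemma measurable_euclid_norm : measurable_fun setT euclid_norm.
Proof.
apply: (measurableT_comp (continuous_measurable_fun (@sqrt_continuous R))).
apply: measurable_sum => i; apply: measurable_funX; exact: measurable_tnth.
Qed.

Lemma measurable_euclid_ball r : measurable (euclid_ball r).
Proof.
rewrite (_ : euclid_ball r = euclid_norm @^-1` `]-oo, r]%classic).
  by rewrite -[X in measurable X]setTI; exact: measurable_euclid_norm.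
by apply/seteqP; split=> x /=; rewrite in_itv.
Qed.

Definition lebesgue_Rn : {sigma_finite_measure set Rn -> \bar R} :=
  power_measure (@lebesgue_measure R) n.

Lemma lebesgue_Rn_cube a : 0 < a ->
  lebesgue_Rn [set t | forall i, `[- a, a]%classic (tnth t i)] =
  ((a + a) ^+ n)%:E.
Proof.
move=> a0; rewrite /lebesgue_Rn.
transitivity (\prod_(i < n) (@lebesgue_measure R) `[(- a)%R, a]%classic)%E.
  have box := power_measure_box (@lebesgue_measure R)
    (A := fun _ : 'I_n => `[- a, a]%classic).
  by apply: box => i; exact: measurable_itv.
rewrite (eq_bigr (fun=> (a + a)%:E)) => [|i _].
  by rewrite prodEFin prodr_const card_ord.
by rewrite lebesgue_measure_itv /= lte_fin gtrN// -EFinB opprK.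
Qed.

Lemma euclid_ball_volume r : 0 < r -> (0 < lebesgue_Rn (euclid_ball r) < +oo)%E.
Proof.
move=> r0; have mcube a :
    measurable [set t : Rn | forall i, `[- a, a]%classic (tnth t i)].
  rewrite (_ : [set _ | _] = \bigcap_(i in [set: 'I_n])
      ((fun t : Rn => tnth t i) @^-1` `[- a, a]%classic)); last first.
    by apply/seteqP; split=> t /= h; [move=> i _; exact: h|move=> i; exact: h].
  apply: fin_bigcap_measurable => // i _.
  by rewrite -[X in measurable X]setTI; exact: measurable_tnth.
have mb := measurable_euclid_ball r.
apply/andP; split.
  have a0 : 0 < r / n.+1%:R by rewrite divr_gt0.
  apply: (@lt_le_trans _ _ (((r / n.+1%:R + r / n.+1%:R) ^+ n)%:E)).
    by rewrite lte_fin exprn_gt0// addr_gt0.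
  rewrite -lebesgue_Rn_cube// le_measure ?inE// => t /= ht.
  rewrite /euclid_ball /= /euclid_norm -[leRHS]gtr0_norm//.
  rewrite -sqrtr_sqr ler_wsqrtr//.
  apply: (@le_trans _ _ (\sum_(i < n) (r / n.+1%:R) ^+ 2)).
    apply: ler_sum => i _; rewrite -real_normK ?num_real// lerXn2r ?nnegrE//.
      exact: ltW.
    by rewrite ler_norml; have := ht i; rewrite in_itv.
  rewrite sumr_const card_ord expr_div_n -mulrnAr -[leRHS]mulr1.
  rewrite ler_wpM2l ?sqr_ge0// -mulr_natr mulrC ler_pdivrMr ?exprn_gt0// mul1r.
  by rewrite -natrX ler_nat (leq_trans (leqnSn n))// leq_pmulr.
apply: (@le_lt_trans _ _ (((r + r) ^+ n)%:E)); last exact: ltry.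
rewrite -lebesgue_Rn_cube// le_measure ?inE// => t /= ht i.
rewrite in_itv /= -ler_norml; apply: le_trans ht.
rewrite -sqrtr_sqr ler_wsqrtr// (bigD1 i)//= lerDl.
by apply: sumr_ge0 => j _; exact: sqr_ge0.
Qed.

(* The Dirac mass is the fallback that mnormalize requires; it is not used when
   r > 0, by euclid_ball_volume. *)
Definition uniform_euclid_ball (r : R) : probability Rn R :=
  mnormalize (mrestr lebesgue_Rn (measurable_euclid_ball r))
    (\d_([tuple of nseq n 0] : Rn)).

Lemma uniform_euclid_ballE r (A : set Rn) : 0 < r ->
  uniform_euclid_ball r A =
  (lebesgue_Rn (A `&` euclid_ball r) *
    (fine (lebesgue_Rn (euclid_ball r)))^-1%:E)%E.
Proof.
move=> /euclid_ball_volume /andP[v0 voo].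
have vT : mrestr lebesgue_Rn (measurable_euclid_ball r) [set: Rn] =
    lebesgue_Rn (euclid_ball r) by rewrite /mrestr setTI.
by rewrite /uniform_euclid_ball /= /mnormalize /= vT gt_eqF ?lt_eqF.
Qed.

(* p.d.f. of the spherical Gaussian with mean mu and covariance
   (sigma ^ 2 / (2 * pi)) * I *)
Definition gauss_pdf (mu : Rn) (sigma : R) (x : Rn) : R :=
  sigma ^- n * expR (- (pi * euclid_dist x mu ^+ 2 / sigma ^+ 2)).

Variable k : nat.
Implicit Types mus nus : k.-tuple Rn.

Definition mixture_pdf mus (x : Rn) : R :=
  k%:R^-1 * \sum_(j < k) gauss_pdf (tnth mus j) 1 x.

Definition mean_bounded (r : R) mus := forall j, euclid_norm (tnth mus j) <= r.

Definition well_separated (r : R) mus :=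
  forall i j, i != j -> r <= euclid_dist (tnth mus i) (tnth mus j).

Definition matching_cost mus nus (s : 'S_k) : R :=
  \sum_(j < k) euclid_dist (tnth mus j) (tnth nus (s j)).

(* The minimum over all permutations; the default value of the big operator is
   the cost of the identity, hence one of the terms. *)
Definition param_dist mus nus : R :=
  \big[Num.min/matching_cost mus nus 1%g]_(s : 'S_k) matching_cost mus nus s.

(* The law of k independent means, each uniform on the centered ball of radius
   r. *)
Definition random_means (r : R) :=
  power_measure (uniform_euclid_ball r) k.

End euclidean.

Arguments lebesgue_Rn R n : clear implicits.
Arguments euclid_ball {R} n r.
Arguments uniform_euclid_ball {R} n r.
Arguments random_means {R} n k r.

(* Main.v *)
Require Import Defs.
From mathcomp Require Import all_boot all_order all_algebra.
From mathcomp Require Import fingroup perm.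
From mathcomp Require Import all_classical all_reals all_analysis.
From mathcomp Require Import measurable_realfun ring lra zify.

(* Write l = ln C and L = ln k, so that d is about L / (4 l).  Up to the factor
   exp (- pi |x|^2) and a tiny error, the density of a mixture with means mu_j is
   a polynomial in x of degree less than D = O(C d), whose coefficients are the
   moments M_a = 1/k sum_j exp (- pi |mu_j|^2) mu_j^a with |a| < D.  There are at
   most 'C(d + D, d) <= C ^ (2 d) <= sqrt k of them, so rounding each to a grid of
   mesh k ^ (-C) C ^ (-d) splits the mixtures into at most k ^ k cells, and two
   mixtures of the same cell are k ^ (-C)-close in L1.  On the other hand a random
   mean falls within r = C ^ (-24) sqrt L of a given point with probability at
   most k ^ (-3), so a random mixture is within r of the representative of its own
   cell with probability at most k ^ k * k! * k ^ (-3 k) <= 1 / k, and is not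
   r-separated with probability at most k ^ 2 * k ^ (-3) = 1 / k. *)

Set Implicit Arguments.
Unset Strict Implicit.
Unset Printing Implicit Defensive.

Import Order.TTheory GRing.Theory Num.Theory.
Import numFieldNormedType.Exports.
Local Open Scope classical_set_scope.
Local Open Scope ring_scope.

(** * Taylor expansion of mixture densities *)

Lemma series_exp_coeff_le (R : realType) (x : R) n : 0 <= x ->
  series (exp_coeff x) n <= expR x.
Proof.
move=> x0; apply: nondecreasing_cvgn_le; last exact: is_cvg_series_exp_coeff.
apply/nondecreasing_seqP => i; rewrite !seriesEnat /= big_nat_recr //= lerDl.
exact: exp_coeff_ge0.
Qed.

(** For [m >= n] and [s >= 1] one has [|z|^m <= s^-n (s |z|)^m], so the tail is at most [s^-n] times
    the full series of [expR (s * |z|)]. The parameter [s] trades a smaller prefactor against a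
    larger exponential. *)
Lemma expR_taylor_remainder (R : realType) (z s : R) n : 1 <= s ->
  `|expR z - \sum_(m < n) z ^+ m / m`!%:R| <= s ^- n * expR (s * `|z|).
Proof.
move=> s1; have s0 : 0 < s by exact: lt_le_trans s1.
have sz0 : 0 <= s * `|z| by rewrite mulr_ge0 // ltW.
have cz : series (exp_coeff z) i - \sum_(m < n) z ^+ m / m`!%:R @[i --> \oo]
    --> expR z - \sum_(m < n) z ^+ m / m`!%:R.
  apply: cvgB; last exact: cvg_cst.
  exact: is_cvg_series_exp_coeff.
have /cvg_norm cz' := cz.
rewrite -(cvg_lim (@Rhausdorff R) cz').
apply: limr_le.
  by apply/cvg_ex; exists `|expR z - \sum_(m < n) z ^+ m / m`!%:R|.
near=> N.
have nN : (n <= N)%N by near: N; exact: nbhs_infty_ge.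
rewrite /= seriesEnat /= -(big_mkord xpredT (fun m => z ^+ m / m`!%:R)).
rewrite (big_cat_nat (leq0n n) nN) //= addrAC subrr add0r.
apply: (le_trans (ler_norm_sum _ _ _)).
apply: le_trans (ler_wpM2l _ (series_exp_coeff_le N sz0)); last first.
  by rewrite invr_ge0 exprn_ge0 // ltW.
rewrite seriesEnat /= mulr_sumr [leRHS](big_cat_nat (leq0n n) nN) //=.
rewrite -[leLHS]add0r lerD //.
  apply: sumr_ge0 => i _; rewrite mulr_ge0 //; last exact: exp_coeff_ge0.
  by rewrite invr_ge0 exprn_ge0 // ltW.
rewrite big_nat_cond [leRHS]big_nat_cond; apply: ler_sum => i.
rewrite andbT => /andP[ni _].
rewrite /exp_coeff /= normrM normrX [`| _^-1|]ger0_norm ?invr_ge0 ?ler0n //.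
rewrite mulrA ler_wpM2r ?invr_ge0 ?ler0n // exprMn mulrA ler_peMl ?exprn_ge0 //.
by rewrite mulrC ler_pdivlMr ?exprn_gt0 // mul1r ler_weXn2l.
Unshelve. all: by end_near. Qed.

(** * Powers of an inner product as sums over words *)

Lemma expr_sum_prod (R : comNzRingType) (d m : nat) (x y : 'I_d -> R) :
  (\sum_i x i * y i) ^+ m = \sum_(w : {ffun 'I_m -> 'I_d})
     (\prod_l x (w l)) * (\prod_l y (w l)).
Proof.
rewrite -[in LHS](card_ord m) -prodr_const bigA_distr_bigA /=.
by apply: eq_bigr => w _; rewrite big_split.
Qed.

(** Expanding over words avoids multinomial coefficients. A word matters only through its letter
    counts, which form a multi-index; this is how moments enter. *)
Lemma prod_word (R : comNzRingType) (d m : nat) (y : 'I_d -> R)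
    (w : {ffun 'I_m -> 'I_d}) :
  \prod_l y (w l) = \prod_i y i ^+ #|[pred l | w l == i]|.
Proof.
rewrite (partition_big w xpredT) //=; apply: eq_bigr => i _.
by rewrite -prodr_const; apply: eq_big => [l|l /eqP <-].
Qed.

Lemma sum_word (d m : nat) (w : {ffun 'I_m -> 'I_d}) :
  (\sum_i #|[pred l | w l == i]|)%N = m.
Proof.
rewrite -[RHS](card_ord m) -sum1_card (partition_big w xpredT) //=.
by apply: eq_bigr => i _; rewrite -sum1_card.
Qed.

Section moments.
Variables (R : realType) (d k : nat).
Local Notation Rd := (d.-tuple (measurableTypeR R)).
Implicit Types (x mu : Rd) (mus nus : k.-tuple Rd).

Definition sqnorm x : R := \sum_i tnth x i ^+ 2.

Definition dot x mu : R := \sum_i tnth x i * tnth mu i.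

(** Expanding [|x - mu|^2] leaves the weight [expR (- pi |mu|^2)] on each mean once the factor in
    [x] alone is split off. The exponent [a] is a plain function so that both letter counts and
    index tuples can be used. *)
Definition moment mus (a : 'I_d -> nat) : R := k%:R^-1 * \sum_j
  expR (- (pi * sqnorm (tnth mus j))) * \prod_i tnth (tnth mus j) i ^+ a i.

(** The weighted average over the means of the Taylor polynomials of [expR (2 * pi * dot x mu)], of
    degree below [n], rearranged to be linear in the moments. *)
Definition taylor_poly n mus x : R :=
  \sum_(m < n) (2 * pi) ^+ m / m`!%:R * \sum_(w : {ffun 'I_m -> 'I_d})
    (\prod_l tnth x (w l)) * moment mus (fun i => #|[pred l | w l == i]|).

Lemma sqnorm_ge0 x : 0 <= sqnorm x.
Proof. by apply: sumr_ge0 => i _; exact: sqr_ge0. Qed.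

Lemma sqr_euclid_norm x : euclid_norm x ^+ 2 = sqnorm x.
Proof. by rewrite sqr_sqrtr // sqnorm_ge0. Qed.

Lemma euclid_norm_ge0 x : 0 <= euclid_norm x.
Proof. exact: sqrtr_ge0. Qed.

Lemma gauss_pdf1E mu x : gauss_pdf mu 1 x =
  expR (- (pi * sqnorm x)) * expR (- (pi * sqnorm mu)) *
  expR (2 * pi * dot x mu).
Proof.
rewrite /gauss_pdf expr1n invr1 mul1r expr1n divr1 /euclid_dist sqr_euclid_norm.
rewrite -!expRD; congr expR.
have -> : sqnorm [tuple tnth x i - tnth mu i | i < d] =
    sqnorm x + sqnorm mu - 2 * dot x mu.
  rewrite /sqnorm /dot mulr_sumr -big_split -sumrB; apply: eq_bigr => i _.
  by rewrite tnth_mktuple /=; ring.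
ring.
Qed.

(** Coordinatewise AM-GM: the difference is [pi / 2 * (u - 2 * s * v) ^+ 2] or its analogue with a
    plus sign. The weight [pi / 2] spends only half of the decay [expR (- pi |x|^2)], which keeps
    the error integrable. *)
Lemma dot_le (s : R) x mu : 0 <= s ->
  s * `|2 * pi * dot x mu| <= pi / 2 * sqnorm x + 2 * pi * s ^+ 2 * sqnorm mu.
Proof.
move=> s0; rewrite /dot /sqnorm mulr_sumr !mulr_sumr.
rewrite -big_split /=.
apply: le_trans (ler_wpM2l s0 (ler_norm_sum _ _ _)) _.
rewrite mulr_sumr; apply: ler_sum => i _.
set u := tnth x i; set v := tnth mu i.
have p0 := pi_gt0 R.
rewrite -[s in leLHS](ger0_norm s0) -normrM ler_norml.
have h1 : 0 <= pi / 2 * (u - 2 * s * v) ^+ 2.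
  by rewrite mulr_ge0 ?sqr_ge0 // divr_ge0 ?ltW.
have h2 : 0 <= pi / 2 * (u + 2 * s * v) ^+ 2.
  by rewrite mulr_ge0 ?sqr_ge0 // divr_ge0 ?ltW.
apply/andP; split; rewrite -subr_ge0.
- by rewrite (_ : _ - _ = pi / 2 * (u + 2 * s * v) ^+ 2) //; field.
- by rewrite (_ : _ - _ = pi / 2 * (u - 2 * s * v) ^+ 2) //; field.
Qed.

Lemma taylor_polyE n mus x : expR (- (pi * sqnorm x)) * taylor_poly n mus x =
  k%:R^-1 * \sum_j expR (- (pi * sqnorm x)) *
    expR (- (pi * sqnorm (tnth mus j))) *
    \sum_(m < n) (2 * pi * dot x (tnth mus j)) ^+ m / m`!%:R.
Proof.
under [in RHS]eq_bigr do rewrite -mulrA.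
rewrite -mulr_sumr [RHS]mulrCA; congr (_ * _).
under [in RHS]eq_bigr do rewrite mulr_sumr.
rewrite exchange_big mulr_sumr /taylor_poly; apply: eq_bigr => m _.
rewrite [RHS]mulr_sumr.
under [in RHS]eq_bigr => j _.
  rewrite exprMn /dot expr_sum_prod.
  rewrite (_ : _ * _ = (2 * pi) ^+ m / m`!%:R * \sum_(w : {ffun 'I_m -> 'I_d})
    (\prod_l tnth x (w l)) * (expR (- (pi * sqnorm (tnth mus j))) *
    \prod_l tnth (tnth mus j) (w l))); last first.
    under [in RHS]eq_bigr do rewrite mulrCA.
    by rewrite -!mulr_sumr; ring.
  over.
rewrite -mulr_sumr -mulr_sumr exchange_big mulrCA; congr (_ * _).
rewrite mulr_sumr.
apply: eq_bigr => w _; rewrite -mulr_sumr mulrCA /moment; congr (_ * (_ * _)).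
by apply: eq_bigr => j _; rewrite prod_word.
Qed.

Lemma mean_average_le (F : 'I_k -> R) (B : R) : 0 <= B ->
  (forall j, `|F j| <= B) -> `|k%:R^-1 * \sum_j F j| <= B.
Proof.
(* For [k = 0] the inverse of [k] is [0], and so is the average. *)
move=> B0 FB; have [k0|k0] := posnP k.
  have -> : k%:R = 0 :> R by rewrite k0.
  by rewrite invr0 mul0r normr0.
rewrite normrM ger0_norm ?invr_ge0 ?ler0n // ler_pdivrMl ?ltr0n //.
apply: le_trans (ler_norm_sum _ _ _) _.
apply: le_trans (ler_sum _ (fun j _ => FB j)) _.
by rewrite sumr_const card_ord mulr_natl.
Qed.

(** The remainder bound is applied to each mean at [z = 2 * pi * dot x mu]; [dot_le] and
    [|mu|^2 <= d] then bound the exponent by [2 pi s^2 d - pi |x|^2 / 2]. *)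
Lemma mixture_pdf_taylor n (s : R) mus x : 1 <= s ->
  mean_bounded (Num.sqrt d%:R) mus ->
  `|mixture_pdf mus x - expR (- (pi * sqnorm x)) * taylor_poly n mus x| <=
  s ^- n * expR (2 * pi * s ^+ 2 * d%:R) * expR (- (pi / 2 * sqnorm x)).
Proof.
move=> s1 mb; have s0 : 0 < s by exact: lt_le_trans s1.
rewrite taylor_polyE /mixture_pdf -mulrBr -sumrB.
apply: mean_average_le => [|j].
  by rewrite !mulr_ge0 ?expR_ge0 // invr_ge0 exprn_ge0 // ltW.
rewrite gauss_pdf1E -mulrBr normrM ger0_norm ?mulr_ge0 ?expR_ge0 //.
apply: le_trans (ler_wpM2l _ (expR_taylor_remainder _ n s1)) _.
  by rewrite mulr_ge0 ?expR_ge0.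
rewrite mulrCA -[leRHS]mulrA ler_wpM2l ?invr_ge0 ?exprn_ge0 ?(ltW s0) //.
rewrite -!expRD ler_expR.
have Qd : sqnorm (tnth mus j) <= d%:R.
  rewrite -sqr_euclid_norm -[leRHS]sqr_sqrtr ?ler0n //.
  by rewrite lerXn2r ?nnegrE ?sqrtr_ge0 //; exact: mb.
have p0 := pi_gt0 R.
have h := dot_le x (tnth mus j) (ltW s0).
have h1 : 0 <= pi * sqnorm (tnth mus j) by rewrite mulr_ge0 ?sqnorm_ge0 ?ltW.
have h2 : 2 * pi * s ^+ 2 * sqnorm (tnth mus j) <= 2 * pi * s ^+ 2 * d%:R.
  by rewrite ler_wpM2l // mulr_ge0 ?sqr_ge0 // mulr_ge0 // ltW.
lra.
Qed.

(** Summing the absolute monomials over words of length [m] gives the [m]-th power of the l1 norm of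
    [x], so the errors add up to a partial sum of the exponential series at [2 pi] times that
    norm. *)
Lemma taylor_poly_dist n (eta : R) mus nus x :
  (forall a : d.-tuple 'I_n.+1, (\sum_(i <- a) i <= n)%N ->
    `|moment mus (tnth a) - moment nus (tnth a)| <= eta) ->
  `|taylor_poly n mus x - taylor_poly n nus x| <=
  eta * expR (2 * pi * \sum_i `|tnth x i|).
Proof.
move=> H.
have p0 := pi_gt0 R.
(* The hypothesis is evaluated at the zero multi-index. *)
have eta0 : 0 <= eta.
  apply: le_trans (normr_ge0 _) (H [tuple ord0 | i < d] _).
  by rewrite big_tuple big1 // => i _; rewrite tnth_mktuple.
rewrite /taylor_poly -sumrB.
apply: le_trans (ler_norm_sum _ _ _) _.
set y := \sum_i `|tnth x i|.
have y0 : 0 <= y by apply: sumr_ge0.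
apply: (@le_trans _ _ (eta * series (exp_coeff (2 * pi * y)) n)); last first.
  by rewrite ler_wpM2l // series_exp_coeff_le // !mulr_ge0 // ltW.
rewrite seriesEnat /= big_mkord mulr_sumr; apply: ler_sum => m _.
rewrite -mulrBr -sumrB normrM ger0_norm; last first.
  by rewrite divr_ge0 ?ler0n // exprn_ge0 // mulr_ge0 // ltW.
rewrite /exp_coeff /= [(_ * y) ^+ m]exprMn.
rewrite (_ : eta * _ = (2 * pi) ^+ m / m`!%:R * (eta * y ^+ m)); last by ring.
rewrite ler_wpM2l //.
  by rewrite divr_ge0 ?ler0n // exprn_ge0 // mulr_ge0 // ltW.
apply: le_trans (ler_norm_sum _ _ _) _.
have -> : y ^+ m = \sum_(w : {ffun 'I_m -> 'I_d}) \prod_l `|tnth x (w l)|.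
  rewrite /y (eq_bigr (fun i => `|tnth x i| * 1)); last first.
    by move=> i _; rewrite mulr1.
  by rewrite expr_sum_prod; apply: eq_bigr => w _; rewrite big1_eq mulr1.
rewrite mulr_sumr; apply: ler_sum => w _.
rewrite -mulrBr normrM normr_prod mulrC ler_wpM2r ?prodr_ge0 //.
have cm i : (#|[pred l | w l == i]| < n.+1)%N.
  rewrite ltnS; apply: leq_trans (ltnW (ltn_ord m)).
  by rewrite -[leqRHS](card_ord m); exact: max_card.
pose a := [tuple Ordinal (cm i) | i < d].
rewrite (_ : (fun i => _) = (fun i => tnth a i : nat)); last first.
  by apply/funext => i; rewrite tnth_mktuple.
apply: H; rewrite big_tuple (eq_bigr (fun i => #|[pred l | w l == i]|)).
  by rewrite sum_word ltnW.
by move=> i _; rewrite tnth_mktuple.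
Qed.

Lemma mixture_pdf_dist n (eta s : R) mus nus x : 1 <= s ->
  mean_bounded (Num.sqrt d%:R) mus -> mean_bounded (Num.sqrt d%:R) nus ->
  (forall a : d.-tuple 'I_n.+1, (\sum_(i <- a) i <= n)%N ->
    `|moment mus (tnth a) - moment nus (tnth a)| <= eta) ->
  `|mixture_pdf mus x - mixture_pdf nus x| <=
  (eta * expR (2 * pi * d%:R) + 2 * (s ^- n * expR (2 * pi * s ^+ 2 * d%:R))) *
  expR (- (pi / 2 * sqnorm x)).
Proof.
move=> s1 bm bn H.
have h1 := mixture_pdf_taylor n x s1 bm.
have h2 := mixture_pdf_taylor n x s1 bn.
have h3 : `|expR (- (pi * sqnorm x)) * taylor_poly n mus x -
    expR (- (pi * sqnorm x)) * taylor_poly n nus x| <=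
    eta * expR (2 * pi * d%:R) * expR (- (pi / 2 * sqnorm x)).
  rewrite -mulrBr normrM ger0_norm ?expR_ge0 //.
  apply: le_trans (ler_wpM2l (expR_ge0 _) (taylor_poly_dist x H)) _.
  rewrite mulrCA -[leRHS]mulrA ler_wpM2l //.
    apply: le_trans (normr_ge0 _) (H [tuple ord0 | i < d] _).
    by rewrite big_tuple big1 // => i _; rewrite tnth_mktuple.
  (* In each coordinate [2 pi u - pi u^2 <= 2 pi - pi u^2 / 2], the difference being
     [pi / 2 * (u - 2) ^+ 2]; this produces the factor [expR (2 * pi * d)]. *)
  rewrite -!expRD ler_expR /sqnorm.
  rewrite -[d in 2 * pi * d%:R]card_ord -sumr_const !mulr_sumr -!sumrN.
  rewrite -!big_split /=.
  apply: ler_sum => i _; rewrite -[tnth x i ^+ 2]real_normK ?num_real //.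
  set u := `|_|; rewrite -subr_ge0.
  rewrite (_ : _ - _ = pi / 2 * (u - 2) ^+ 2); last by field.
  by rewrite mulr_ge0 ?sqr_ge0 // divr_ge0 ?pi_ge0.
move: h1 h2 h3; rewrite !ler_norml => /andP[a1 a2] /andP[b1 b2] /andP[c1 c2].
by apply/andP; split; lra.
Qed.

End moments.

(** * Powers of a measure *)

Lemma measurable_exists (D : measure_display) (X : measurableType D)
    (I : finType) (F : I -> set X) :
  (forall i, measurable (F i)) -> measurable [set x | exists i, F i x].
Proof.
move=> mF; rewrite (_ : [set x | _] = \bigcup_(i in [set: I]) F i).
  exact: fin_bigcup_measurable.
by apply/seteqP; split => z /= [i]; [move=> ?; exists i|move=> _ ?; exists i].
Qed.

Section power_measure_theory.
Context {dsp : measure_display} {T : measurableType dsp} {R : realType}.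

Lemma power_measure_setT (P : probability T R) n :
  power_measure P n [set: n.-tuple T] = 1%E.
Proof.
have := power_measure_box P (n := n) (A := fun=> setT) (fun=> measurableT).
rewrite big1 => [|i _]; last exact: probability_setT.
by move=> <-; congr (power_measure _ _ _); apply/seteqP.
Qed.

Lemma measurable_tnth_pair n (W : set (T * T)) (i j : 'I_n) : measurable W ->
  measurable [set t : n.-tuple T | W (tnth t i, tnth t j)].
Proof.
move=> mW; rewrite -[X in measurable X]setTI.
have : measurable_fun setT (fun t : n.-tuple T => (tnth t i, tnth t j)).
  by apply/measurable_fun_pairP; split => /=; exact: measurable_tnth.
exact.
Qed.

Lemma measurable_some_pair n (W : set (T * T)) : measurable W ->
  measurable [set t : n.-tuple T |
    exists i j : 'I_n, (i < j)%N /\ W (tnth t i, tnth t j)].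
Proof.
move=> mW.
rewrite (_ : [set t | _] = \bigcup_(i in [set: 'I_n])
   \bigcup_(j in [set j : 'I_n | (i < j)%N]) [set t | W (tnth t i, tnth t j)]).
  apply: fin_bigcup_measurable => // i _.
  apply: fin_bigcup_measurable => // j _.
  exact: measurable_tnth_pair.
apply/seteqP; split => t /=.
  by move=> [i [j [ij Wij]]]; exists i => //; exists j.
by move=> [i _ [j ij Wij]]; exists i, j.
Qed.

Lemma measure_exists_le (D : measure_display) (X : measurableType D)
    (I : finType) (m : {measure set X -> \bar R}) (F : I -> set X) (p : R) :
  (forall i, measurable (F i)) -> (forall i, m (F i) <= p%:E)%E ->
  (m [set x | exists i, F i x] <= (#|I|%:R * p)%:E)%E.
Proof.
move=> mF Fp.
have -> : [set x | exists i, F i x] = \big[setU/set0]_(i <- enum I) F i.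
  rewrite -bigcup_seq; apply/seteqP; split => x /= [i].
    by move=> Fi; exists i; rewrite //= mem_enum.
  by move=> _ Fi; exists i.
rewrite cardE; elim: (enum I) => [|i s IHs].
  by rewrite big_nil measure0 mul0r.
rewrite big_cons; apply: le_trans (measureU2 _ _ _) _ => //.
  exact: bigsetU_measurable.
by rewrite /= -natr1 mulrDl mul1r addrC EFinD leeD.
Qed.

(** Induction on [n]: a new first point forms [n] new pairs, each of probability at most [p] by
    integrating over sections, and [n + n^2 <= (n + 1)^2]. *)
Lemma power_measure_some_pair (P : probability T R) (W : set (T * T))
    (p : R) n : measurable W -> 0 <= p -> (forall x, P (xsection W x) <= p%:E)%E ->
  (power_measure P n [set t : n.-tuple T |
    exists i j : 'I_n, (i < j)%N /\ W (tnth t i, tnth t j)] <=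
    ((n ^ 2)%:R * p)%:E)%E.
Proof.
move=> mW p0 Wp; elim: n => [|n IHn].
  rewrite (_ : [set t | _] = set0) ?measure0 ?mul0r //.
  by apply/seteqP; split => t //= [] [].
rewrite /= /cons_measure /pushforward.
set bad := [set t | _] in IHn.
pose F (j : 'I_n) := [set z : T * n.-tuple T | W (z.1, tnth z.2 j)].
have mF j : measurable (F j).
  rewrite -[X in measurable X]setTI.
  have : measurable_fun setT (fun z : T * n.-tuple T => (z.1, tnth z.2 j)).
    apply/measurable_fun_pairP; split; first exact: measurable_fst.
    exact: (measurableT_comp (measurable_tnth j) measurable_snd).
  exact.
have mbad : measurable bad by exact: measurable_some_pair.
have mE : measurable [set z | exists j, F j z] by exact: measurable_exists.
rewrite (_ : _ @^-1` _ =
    [set z | exists j, F j z] `|` (setT `*` bad)); last first.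
  apply/seteqP; split => -[x t] /=.
    move=> [i [j]]; case: (unliftP ord0 j) => [j' ->|->]; last by case.
    case: (unliftP ord0 i) => [i' ->|->]; rewrite ?tnthS => -[ij Wij].
      by right; split => //; exists i', j'.
    by left; exists j'; rewrite /F /=.
  move=> [[j Wj]|[_ [i [j [ij Wij]]]]].
    by exists ord0, (lift ord0 j); rewrite tnthS.
  by exists (lift ord0 i), (lift ord0 j); rewrite !tnthS.
apply: le_trans (measureU2 _ _ _) _ => //; first exact: measurableX.
have FP j : ((P \x power_measure P n) (F j) <= p%:E)%E.
  rewrite /= /product_measure1.
  apply: (@le_trans _ _ (\int[P]_x (cst p%:E) x)%E); last first.
    rewrite integral_cst // [X in (_ * X)%E](_ : _ = 1%E) ?mule1 //.
    exact: (@probability_setT _ _ _ P).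
  apply: ge0_le_integral => //; first exact: measurable_fun_xsection.
  move=> x _ /=; apply: le_trans (Wp x).
  (* The section constrains coordinate [j] only, so it is a box whose other sides are [setT], of
     mass 1. *)
  have := power_measure_box P (n := n)
    (A := fun i => if i == j then xsection W x else setT).
  rewrite (bigD1 j) //= eqxx big1 => [|i /negbTE ->]; last first.
    exact: probability_setT.
  rewrite mule1 => <-; last first.
    by move=> i; case: ifP => // _; exact: measurable_xsection.
  rewrite le_eqVlt; apply/orP; left; apply/eqP; congr (power_measure P n _).
  apply/seteqP; split => t /=.
    rewrite /xsection /= inE => Wt i; case: ifP => // /eqP -> /=.
    by rewrite inE.
  by move=> /(_ j); rewrite eqxx /xsection /= !inE.
have := measure_exists_le mF FP; rewrite card_ord => h1.
have h2 : ((P \x power_measure P n) (setT `*` bad) <= ((n ^ 2)%:R * p)%:E)%E.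
  rewrite product_measure1E // [X in (X * _)%E](_ : _ = 1%E) ?mul1e //.
  exact: (@probability_setT _ _ _ P).
apply: le_trans (leeD h1 h2) _.
rewrite -EFinD lee_fin -mulrDl ler_wpM2r // -natrD ler_nat; lia.
Qed.

(** Tonelli, by induction on the number of coordinates. *)
Lemma integral_power_measure (m : {sigma_finite_measure set T -> \bar R}) n
    (phi : 'I_n -> T -> R) :
  (forall i, measurable_fun setT (phi i)) -> (forall i x, 0 <= phi i x) ->
  (\int[power_measure m n]_t (\prod_i phi i (tnth t i))%:E =
   \prod_i \int[m]_x (phi i x)%:E)%E.
Proof.
elim: n phi => [|n IHn] phi mphi phi0.
  rewrite big_ord0 /= integral_dirac //; last first.
    by under eq_fun do rewrite big_ord0; exact: measurable_cst.
  by rewrite diracT mul1e big_ord0.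
have mprod k (psi : 'I_k -> T -> R) : (forall i, measurable_fun setT (psi i)) ->
    measurable_fun setT (fun t : k.-tuple T => \prod_i psi i (tnth t i)).
  move=> mpsi; apply: measurable_prod => i _.
  by apply: measurableT_comp => //; exact: measurable_tnth.
rewrite big_ord_recl -IHn //=.
(* Naming the measure as an image under [tuple_cons] opens the way to the change of variables. *)
transitivity (\int[pushforward (m \x power_measure m n)%E (@tuple_cons _ T n)]_t
  (\prod_i phi i (tnth t i))%:E)%E.
  apply: eq_measure_integral; first exact: measurable_tuple_cons.
  by move=> A mA _.
rewrite ge0_integral_pushforward //; last 3 first.
- exact: measurable_tuple_cons.
- by apply/measurable_EFinP; exact: mprod.
- by move=> t _; rewrite lee_fin prodr_ge0.
rewrite preimage_setT fubini_tonelli1 //=; last 2 first.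
- apply/measurable_EFinP.
  exact: (measurableT_comp (mprod _ phi mphi) (@measurable_tuple_cons _ T n)).
- by move=> z; rewrite lee_fin prodr_ge0.
pose I := (\int[power_measure m n]_t
  (\prod_(i < n) phi (lift ord0 i) (tnth t i))%:E)%E.
transitivity (\int[m]_x (I * (phi ord0 x)%:E))%E.
  apply: eq_integral => x _; rewrite /fubini_F muleC -ge0_integralZl //=.
  - by apply: eq_integral => t _; rewrite big_ord_recl -EFinM; congr (_ * _)%:E;
      apply: eq_bigr => i _; rewrite tnthS.
  - apply/measurable_EFinP.
    exact: (mprod n (fun i => phi (lift ord0 i)) (fun i => mphi _)).
  - by move=> t _; rewrite lee_fin prodr_ge0.
  - by rewrite lee_fin.
have I0 : (0 <= I)%E by apply: integral_ge0 => t _; rewrite lee_fin prodr_ge0.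
have mphi0 : measurable_fun setT (fun x => (phi ord0 x)%:E).
  by apply/measurable_EFinP.
rewrite muleC; apply: (ge0_integralZl m measurableT mphi0) => // x _.
by rewrite lee_fin.
Qed.

End power_measure_theory.

(** * Gaussian integrals and the volume of small balls *)

Section gaussian_volume.
Variables (R : realType) (n : nat).
Local Notation Rn := (n.-tuple (measurableTypeR R)).

Lemma integral_prod_normal_pdf (mu : Rn) (s : R) :
  (\int[lebesgue_Rn R n]_t
     (\prod_i normal_pdf (tnth mu i) s (tnth t i))%:E = 1)%E.
Proof.
have mphi i : measurable_fun setT (normal_pdf (tnth mu i) s).
  exact: measurable_normal_pdf.
have phi0 (i : 'I_n) x : 0 <= normal_pdf (tnth mu i) s x.
  exact: normal_pdf_ge0.
apply: etrans (integral_power_measure (@lebesgue_measure R) mphi phi0) _.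
by rewrite big1 // => i _; exact: integral_normal_pdf.
Qed.

Lemma measurable_prod_normal_pdf (mu : Rn) (s : R) :
  measurable_fun setT
    (fun t : Rn => \prod_i normal_pdf (tnth mu i) s (tnth t i)).
Proof.
apply: measurable_prod => i _.
apply: measurableT_comp; first exact: measurable_normal_pdf.
exact: measurable_tnth.
Qed.

Lemma prod_normal_pdfE (mu t : Rn) (s : R) : s != 0 ->
  \prod_i normal_pdf (tnth mu i) s (tnth t i) =
  normal_peak s ^+ n * expR (- (euclid_dist t mu ^+ 2 / (s ^+ 2 *+ 2))).
Proof.
move=> s0; rewrite (eq_bigr (fun i => normal_peak s *
    expR (- (tnth t i - tnth mu i) ^+ 2 / (s ^+ 2 *+ 2)))); last first.
  by move=> i _; rewrite normal_pdfE.
rewrite big_split /= prodr_const card_ord -expR_sum; congr (_ * expR _).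
rewrite /euclid_dist sqr_euclid_norm /sqnorm mulr_suml -sumrN.
by apply: eq_bigr => i _; rewrite tnth_mktuple mulNr.
Qed.

Lemma measurable_euclid_dist (mu : Rn) :
  measurable_fun setT (fun t : Rn => euclid_dist t mu).
Proof.
rewrite /euclid_dist /euclid_norm.
apply: (measurableT_comp (continuous_measurable_fun (@sqrt_continuous R))).
apply: measurable_sum => i; under eq_fun do rewrite tnth_mktuple.
apply: measurable_funX; apply: measurable_funB => //; exact: measurable_tnth.
Qed.

Lemma euclid_distC (x y : Rn) : euclid_dist x y = euclid_dist y x.
Proof.
rewrite /euclid_dist /euclid_norm; congr Num.sqrt; apply: eq_bigr => i _.
by rewrite !tnth_mktuple -sqrrN opprB.
Qed.

(** The inequality is strict so that the complement is a lower bound by [r], the form found in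
    [well_separated]. *)
Definition near_set (r : R) (mu : Rn) : set Rn :=
  [set t | euclid_dist t mu < r].

Lemma measurable_near_set r mu : measurable (near_set r mu).
Proof.
rewrite (_ : near_set r mu =
    (fun t : Rn => euclid_dist t mu) @^-1` `]-oo, r[%classic).
  by rewrite -[X in measurable X]setTI; exact: measurable_euclid_dist.
by apply/seteqP; split=> x /=; rewrite /near_set /= in_itv.
Qed.

(* On the ball, the Gaussian density of standard deviation s is at least
   normal_peak s ^+ n * expR (- r ^+ 2 / (2 * s ^+ 2)), and it integrates to 1. *)
Lemma lebesgue_near_set_le (mu : Rn) (r s : R) : 0 <= r -> 0 < s ->
  (lebesgue_Rn R n (near_set r mu) <=
   (normal_peak s ^- n * expR (r ^+ 2 / (s ^+ 2 *+ 2)))%:E)%E.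
Proof.
move=> r0 s0; have s0' : s != 0 by rewrite gt_eqF.
have pk := normal_peak_gt0 s0'.
pose c := normal_peak s ^+ n * expR (- (r ^+ 2 / (s ^+ 2 *+ 2))).
have c0 : 0 < c by rewrite mulr_gt0 ?exprn_gt0 ?expR_gt0.
have -> : normal_peak s ^- n * expR (r ^+ 2 / (s ^+ 2 *+ 2)) = c^-1.
  by rewrite /c invfM expRN invrK.
have h : (c%:E * lebesgue_Rn R n (near_set r mu) <= 1)%E.
  rewrite -(integral_prod_normal_pdf mu s).
  rewrite -[X in lebesgue_Rn R n X]setIT -integral_indic //; last first.
    exact: measurable_near_set.
  rewrite -ge0_integralZl //=; last 2 first.
  - apply/measurable_EFinP; apply: measurable_indic; exact: measurable_near_set.
  - by rewrite lee_fin ltW.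
  - apply: ge0_le_integral => //=.
    + by move=> t _; rewrite lee_fin mulr_ge0 // ltW.
    + apply/measurable_EFinP; apply: measurable_funM => //.
      by apply: measurable_indic; exact: measurable_near_set.
    + by apply/measurable_EFinP; exact: measurable_prod_normal_pdf.
    move=> t _; rewrite lee_fin indicE.
    have [|] := boolP (t \in _) => [|_]; last first.
      by rewrite mulr0 prodr_ge0 // => i _; exact: normal_pdf_ge0.
    rewrite inE /near_set /= => tr; rewrite mulr1 prod_normal_pdfE // /c.
    rewrite ler_wpM2l ?exprn_ge0 ?(ltW pk) // ler_expR lerN2 ler_wpM2r //.
      by rewrite invr_ge0 mulrn_wge0 // sqr_ge0.
    by rewrite lerXn2r ?nnegrE ?euclid_norm_ge0 // ltW.
rewrite -[leLHS]mul1e -[in leLHS](@mulVf _ c) ?gt_eqF // EFinM -muleA.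
by rewrite -[leRHS]mule1 lee_wpmul2l // lee_fin invr_ge0 ltW.
Qed.

(** The ball of radius [sqrt n] contains the cube [[-1, 1]^n]. *)
Lemma lebesgue_ball_sqrt_dim_ge : (0 < n)%N ->
  ((2 ^+ n)%:E <= lebesgue_Rn R n (euclid_ball n (Num.sqrt n%:R)))%E.
Proof.
move=> n0; rewrite (_ : 2 = 1 + 1) // -(lebesgue_Rn_cube n (@ltr01 R)).
rewrite le_measure ?inE //; last 2 first.
- exact: measurable_euclid_ball.
- move=> t /= ht; rewrite /euclid_ball /= /euclid_norm ler_wsqrtr //.
  rewrite -[n in n%:R]card_ord -sumr_const; apply: ler_sum => i _.
  have := ht i; rewrite in_itv /= -ler_norml -real_normK ?num_real // => ?.
  by rewrite expr_le1.
rewrite (_ : [set _ | _] = \bigcap_(i in [set: 'I_n])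
    ((fun t : Rn => tnth t i) @^-1` `[- 1, 1]%classic)); last first.
  by apply/seteqP; split=> t /= h; [move=> i _; exact: h|move=> i; exact: h].
apply: fin_bigcap_measurable => // i _.
by rewrite -[X in measurable X]setTI; exact: measurable_tnth.
Qed.

(** Quotient of the upper estimate for the small ball by the lower estimate [2^n] for the sampling
    ball. *)
Lemma uniform_near_set_le (mu : Rn) (r s : R) : (0 < n)%N -> 0 <= r -> 0 < s ->
  (uniform_euclid_ball n (Num.sqrt n%:R) (near_set r mu) <=
   ((normal_peak s ^- n * expR (r ^+ 2 / (s ^+ 2 *+ 2))) / 2 ^+ n)%:E)%E.
Proof.
move=> n0 r0 s0; rewrite uniform_euclid_ballE ?sqrtr_gt0 ?ltr0n //.
have := lebesgue_ball_sqrt_dim_ge n0.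
have /euclid_ball_volume : 0 < Num.sqrt n%:R :> R by rewrite sqrtr_gt0 ltr0n.
move=> /(_ n) /andP[v0 voo].
have /fineK <- : lebesgue_Rn R n (euclid_ball n (Num.sqrt n%:R)) \is a fin_num.
  by rewrite ge0_fin_numE // ltW.
rewrite lee_fin /= => v2; rewrite EFinM; apply: lee_pmul => //.
- by rewrite lee_fin invr_ge0 (le_trans _ v2) // exprn_ge0.
- apply: le_trans (lebesgue_near_set_le mu r0 s0).
  apply: le_measure; rewrite ?inE //=.
  + apply: measurableI; first exact: measurable_near_set.
    exact: measurable_euclid_ball.
  + exact: measurable_near_set.
- rewrite lee_fin lef_pV2 ?posrE ?exprn_gt0 //.
  by rewrite (lt_le_trans _ v2) // exprn_gt0.
Qed.

Lemma uniform_ballC (r : R) : 0 < r ->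
  uniform_euclid_ball n r (~` euclid_ball n r) = 0%E.
Proof. by move=> r0; rewrite uniform_euclid_ballE // setICl measure0 mul0e. Qed.

End gaussian_volume.

(** * Pigeonhole on moments *)

Section event.
Variables (R : realType) (d k : nat).
Local Notation Rd := (d.-tuple (measurableTypeR R)).
Implicit Types (x mu : Rd) (mus nus : k.-tuple Rd).

(** The negation places [nus], up to a permutation, within [r] of [mus] entry by entry. For fixed
    [nus] this is a union of [k!] boxes, whose product measure is explicit. *)
Definition far_apart (r : R) mus nus := forall s : 'S_k,
  exists j, r <= euclid_dist (tnth mus j) (tnth nus (s j)).

(** The components are swapped so that the section at [x] is [near_set r x]. *)
Definition near_pairs (r : R) : set (Rd * Rd) :=
  [set z | euclid_dist z.2 z.1 < r].

Lemma measurable_near_pairs (r : R) : measurable (near_pairs r).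
Proof.
rewrite (_ : near_pairs r =
    (fun z : Rd * Rd => euclid_dist z.2 z.1) @^-1` `]-oo, r[%classic);
  last first.
  by apply/seteqP; split=> x /=; rewrite /near_pairs /= in_itv.
rewrite -[X in measurable X]setTI.
suff : measurable_fun setT (fun z : Rd * Rd => euclid_dist z.2 z.1) by exact.
rewrite /euclid_dist /euclid_norm.
apply: (measurableT_comp (continuous_measurable_fun (@sqrt_continuous R))).
apply: measurable_sum => i; under eq_fun do rewrite tnth_mktuple.
apply: measurable_funX; apply: measurable_funB.
- exact: (measurableT_comp (measurable_tnth i) measurable_snd).
- exact: (measurableT_comp (measurable_tnth i) measurable_fst).
Qed.

Lemma xsection_near_pairs (r : R) x : xsection (near_pairs r) x = near_set r x.
Proof. by apply/seteqP; split => y; rewrite /xsection /near_set /= inE. Qed.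

Lemma measurable_box (A : 'I_k -> set Rd) : (forall j, measurable (A j)) ->
  measurable [set t : k.-tuple Rd | forall j, A j (tnth t j)].
Proof.
move=> mA; rewrite (_ : [set _ | _] = \bigcap_(i in [set: 'I_k])
    ((fun t : k.-tuple Rd => tnth t i) @^-1` A i)); last first.
  by apply/seteqP; split=> t /= h; [move=> i _; exact: h|move=> i; exact: h].
apply: fin_bigcap_measurable => // i _.
by rewrite -[X in measurable X]setTI; exact: measurable_tnth.
Qed.

(* Every cell that contains a bounded separated configuration gets one such
   representative; the exceptional event is that the sample is too close to the
   representative of its own cell, whence only finitely many small sets have to
   be removed and the cells themselves need not be measurable. *)
Lemma pigeonhole_event (P : probability Rd R) (B : set Rd) (r p : R)
    (F : finType) (cell : k.-tuple Rd -> F) :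
  measurable B -> P (~` B) = 0%E -> 0 <= p ->
  (forall x, P (near_set r x) <= p%:E)%E ->
  exists E : set (k.-tuple Rd), [/\ measurable E,
    ((1 - ((k ^ 2)%:R * p + #|F|%:R * (k`!%:R * p ^+ k)))%:E <=
      power_measure P k E)%E &
    forall mus, E mus -> exists nus, [/\
      (forall j, B (tnth mus j)) /\ (forall j, B (tnth nus j)),
      well_separated r mus /\ well_separated r nus,
      cell mus = cell nus & far_apart r mus nus]].
Proof.
move=> mB PB p0 Pp.
pose G mus := (forall j, B (tnth mus j)) /\ well_separated r mus.
(* [rep] picks a good member of each cell that has one; on the other cells it is the arbitrary
   [point]. *)
have /choice[rep repP] (c : F) : exists nus : k.-tuple Rd,
    (exists nus, G nus /\ cell nus = c) -> G nus /\ cell nus = c.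
  have [[nus h]|h] := pselect (exists nus, G nus /\ cell nus = c).
    by exists nus.
  by exists point => /h.
(* Three bad events: a mean outside [B] (a null event), two means closer than [r], and closeness to
   a permuted representative of some cell. *)
pose B0 := [set mus : k.-tuple Rd | exists j, (~` B) (tnth mus j)].
pose B1 := [set mus : k.-tuple Rd |
  exists i j : 'I_k, (i < j)%N /\ near_pairs r (tnth mus i, tnth mus j)].
pose N c (s : 'S_k) := [set mus : k.-tuple Rd |
  forall j, near_set r (tnth (rep c) (s j)) (tnth mus j)].
pose B2 := [set mus : k.-tuple Rd | exists c, exists s, N c s mus].
have mj j : measurable [set mus : k.-tuple Rd | (~` B) (tnth mus j)].
  have mCB : measurable (~` B) by exact: measurableC.
  by rewrite -[X in measurable X]setTI; exact: measurable_tnth.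
have mB0 : measurable B0 by exact: measurable_exists.
have mB1 : measurable B1.
  by apply: measurable_some_pair; exact: measurable_near_pairs.
have mN c s : measurable (N c s).
  apply: (measurable_box (A := fun j => near_set r (tnth (rep c) (s j)))) => j.
  exact: measurable_near_set.
have mNc c : measurable [set mus | exists s, N c s mus].
  exact: measurable_exists.
have mB2 : measurable B2.
  exact: (measurable_exists (F := fun c => [set mus | exists s, N c s mus])).
have PB0 : (power_measure P k B0 <= 0%:E)%E.
  rewrite -[0%R](mulr0 #|'I_k|%:R).
  apply: (measure_exists_le
    (F := fun j => [set mus : k.-tuple Rd | (~` B) (tnth mus j)])) => // j.
  have := power_measure_box P (n := k)
    (A := fun i => if i == j then ~` B else setT).
  rewrite (bigD1 j) //= eqxx big1 => [|i /negbTE ->]; last first.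
    exact: probability_setT.
  rewrite mule1 PB => box0.
  rewrite (_ : [set mus | _] = [set t : k.-tuple Rd |
      forall i, (if i == j then ~` B else setT) (tnth t i)]); last first.
    apply/seteqP; split => t /=.
      by move=> Wt i; case: ifP => // /eqP ->.
    by move=> /(_ j); rewrite eqxx.
  by rewrite box0 // => i; case: ifP => // _; exact: measurableC.
have PB1 : (power_measure P k B1 <= ((k ^ 2)%:R * p)%:E)%E.
  apply: power_measure_some_pair => //; first exact: measurable_near_pairs.
  by move=> x; rewrite xsection_near_pairs.
have PB2 : (power_measure P k B2 <= (#|F|%:R * (k`!%:R * p ^+ k))%:E)%E.
  apply: (measure_exists_le
    (F := fun c => [set mus | exists s, N c s mus])) => // c.
  rewrite -card_Sn; apply: (measure_exists_le (F := N c)) => // s.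
  have box := power_measure_box P
    (fun j => measurable_near_set r (tnth (rep c) (s j))).
  apply: (@le_trans _ _ (\prod_(j < k) P (near_set r (tnth (rep c) (s j))))%E).
    by rewrite -box.
  rewrite -[k in p ^+ k]card_ord -prodr_const -prodEFin.
  (* Nonnegativity is carried along because multiplying inequalities requires nonnegative
     factors. *)
  suff /andP[] : (0 <= \prod_(j < k) P (near_set r (tnth (rep c) (s j))) <=
      \prod_(j in 'I_k) p%:E)%E by [].
  apply: (big_ind2 (fun a b => 0 <= a <= b)%E) => [|a a' b b'|j _].
  - by rewrite lee01 lexx.
  - by move=> /andP[a0 aa'] /andP[b0 bb']; rewrite mule_ge0 // lee_pmul.
  - by rewrite measure_ge0 Pp.
exists (~` (B0 `|` B1 `|` B2)); split.
- by apply: measurableC; apply: measurableU => //; exact: measurableU.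
- have mU : measurable (B0 `|` B1 `|` B2).
    by apply: measurableU => //; exact: measurableU.
  have : (1 <= power_measure P k (~` (B0 `|` B1 `|` B2)) +
      ((k ^ 2)%:R * p + #|F|%:R * (k`!%:R * p ^+ k))%:E)%E.
    rewrite -(power_measure_setT P k) -(setvU (B0 `|` B1 `|` B2)).
    apply: le_trans (measureU2 _ _ _) _ => //; first exact: measurableC.
    rewrite leeD2l //; apply: le_trans (measureU2 _ _ _) _ => //.
      exact: measurableU.
    rewrite EFinD leeD //; apply: le_trans (measureU2 _ _ _) _ => //.
    by rewrite -[leRHS]add0e leeD.
  by rewrite EFinB leeBlDr.
move=> mus /= /not_orP[/not_orP[nB0 nB1] nB2].
have Gmus : G mus.
  split=> [j|i j ij].
    by apply: contrapT => nB; apply: nB0; exists j.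
  rewrite leNgt; apply/negP => rij; apply: nB1.
  move: ij; rewrite neq_ltn => /orP[ij|ij]; [exists i, j|exists j, i].
    by split => //; rewrite /near_pairs /= euclid_distC.
  by split => //; rewrite /near_pairs.
(* [mus] itself witnesses that its cell has a good member, so the representative is good too. *)
have [] := repP (cell mus); first by exists mus.
move=> [Bn sn] cn; exists (rep (cell mus)); split => //.
- by split => //; case: Gmus.
- by split => //; case: Gmus.
move=> s; apply: contrapT => h; apply: nB2.
exists (cell mus), s => j; rewrite /near_set /= ltNge; apply/negP => hj.
by apply: h; exists j.
Qed.

(** * Estimates for moments, parameter distance and L1 distance *)

Lemma euclid_norm_ge_coord x (i : 'I_d) : `|tnth x i| <= euclid_norm x.
Proof.
rewrite -sqrtr_sqr ler_wsqrtr // (bigD1 i) //= lerDl.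
by apply: sumr_ge0 => j _; exact: sqr_ge0.
Qed.

(** The weights are at most 1 and each coordinate is at most [sqrt d <= d] in absolute value, so a
    monomial of degree at most [n] is at most [d^n]. *)
Lemma moment_le n mus (a : d.-tuple 'I_n.+1) : (0 < d)%N ->
  mean_bounded (Num.sqrt d%:R) mus -> (\sum_(i <- a) i <= n)%N ->
  `|moment mus (tnth a)| <= d%:R ^+ n.
Proof.
move=> d0 mb an; have d1 : 1 <= d%:R :> R by rewrite ler1n.
apply: mean_average_le => [|j]; first by rewrite exprn_ge0.
rewrite normrM ger0_norm ?expR_ge0 // -[leRHS]mul1r ler_pM ?expR_ge0 //.
  rewrite expR_le1 oppr_le0 mulr_ge0 ?pi_ge0 //; exact: sqnorm_ge0.
rewrite normr_prod.
apply: (@le_trans _ _ (\prod_i d%:R ^+ tnth a i)); last first.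
  by rewrite -(big_tuple _ _ a xpredT (fun i : 'I_n.+1 => d%:R ^+ i : R)) /=
    -expr_sum ler_weXn2l.
apply: ler_prod => i _; rewrite normr_ge0 normrX /=.
rewrite lerXn2r ?nnegrE //; apply: le_trans (euclid_norm_ge_coord _ _) _.
apply: le_trans (mb j) _.
rewrite -[leRHS]ger0_norm // -sqrtr_sqr ler_wsqrtr // expr2.
by rewrite -[leLHS]mul1r ler_wpM2r.
Qed.

Lemma matching_cost_ge (r : R) mus nus s : far_apart r mus nus ->
  r <= matching_cost mus nus s.
Proof.
move=> /(_ s)[j rj]; rewrite /matching_cost (bigD1 j) //=.
apply: le_trans rj _; rewrite lerDl.
by apply: sumr_ge0 => i _; exact: euclid_norm_ge0.
Qed.

Lemma param_dist_ge (r : R) mus nus : far_apart r mus nus ->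
  r <= param_dist mus nus.
Proof.
move=> h; rewrite /param_dist.
apply: (big_ind (fun y => r <= y)) => [|x y rx ry|s _];
  [|by rewrite le_min rx|];
  exact: matching_cost_ge.
Qed.

Lemma measurable_mixture_pdf mus : measurable_fun setT (mixture_pdf mus).
Proof.
rewrite /mixture_pdf /gauss_pdf.
apply: measurable_funM; first exact: measurable_cst.
apply: measurable_sum => j; apply: measurable_funM; first exact: measurable_cst.
apply: (measurableT_comp (@measurable_expR R)).
apply: (measurableT_comp (@oppr_measurable R _)).
apply: measurable_funM; last exact: measurable_cst.
apply: measurable_funM; first exact: measurable_cst.
apply: measurable_funX; exact: measurable_euclid_dist.
Qed.

Lemma integral_expR_sqnorm :
  (\int[lebesgue_Rn R d]_x (expR (- (pi / 2 * sqnorm x)))%:E =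
   (Num.sqrt 2 ^+ d)%:E)%E.
Proof.
(* With variance [s^2 = 1 / pi] the normal density has exponent [- (pi / 2 * sqnorm x)] and peak
   [1 / sqrt 2] per coordinate, whence the factor [sqrt 2 ^ d]. *)
pose s : R := (Num.sqrt pi)^-1.
have p0 := pi_gt0 R.
have s0 : s != 0 by rewrite invr_neq0 // gt_eqF // sqrtr_gt0.
have s2 : s ^+ 2 = pi^-1 by rewrite exprVn sqr_sqrtr // ltW.
have pk : normal_peak s = (Num.sqrt 2)^-1.
  by rewrite /normal_peak s2 mulVf ?gt_eqF.
pose z : Rd := [tuple 0 | i < d].
have E x : expR (- (pi / 2 * sqnorm x)) =
    Num.sqrt 2 ^+ d * \prod_i normal_pdf (tnth z i) s (tnth x i).
  rewrite prod_normal_pdfE // pk exprVn mulrA divff ?mul1r; last first.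
    by rewrite expf_neq0 // gt_eqF // sqrtr_gt0.
  congr (expR (- _)); rewrite s2 /euclid_dist sqr_euclid_norm.
  rewrite (_ : [tuple _ | _ < _] = x); last first.
    by apply: eq_from_tnth => i; rewrite !tnth_mktuple subr0.
  by rewrite -[pi^-1 *+ 2]mulr_natr invfM invrK mulrC.
under eq_integral do rewrite E EFinM.
rewrite ge0_integralZl //=.
- by rewrite integral_prod_normal_pdf mule1.
- by apply/measurable_EFinP; exact: measurable_prod_normal_pdf.
- by move=> x _; rewrite lee_fin prodr_ge0 // => i _; exact: normal_pdf_ge0.
Qed.

Lemma mixture_L1_le (A : R) mus nus : 0 <= A ->
  (forall x, `|mixture_pdf mus x - mixture_pdf nus x| <=
    A * expR (- (pi / 2 * sqnorm x))) ->
  ('N[lebesgue_Rn R d]_1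
    [ (fun x => (mixture_pdf mus x - mixture_pdf nus x)%:E) ] <=
    (A * Num.sqrt 2 ^+ d)%:E)%E.
Proof.
move=> A0 h; rewrite Lnorm1 EFinM -integral_expR_sqnorm.
have mG : measurable_fun setT (fun x : Rd => (expR (- (pi / 2 * sqnorm x)))%:E).
  apply/measurable_EFinP; apply: (measurableT_comp (@measurable_expR R)).
  apply: (measurableT_comp (@oppr_measurable R _)).
  apply: measurable_funM; first exact: measurable_cst.
  apply: measurable_sum => i; apply: measurable_funX; exact: measurable_tnth.
rewrite -ge0_integralZl //=.
apply: ge0_le_integral => //=.
- apply/measurable_EFinP; apply: measurableT_comp => //.
  by apply: measurable_funB; exact: measurable_mixture_pdf.
- by apply: emeasurable_funM => //; exact: measurable_cst.
- by move=> x _; rewrite -EFinM lee_fin.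
Qed.

(** * Rounding the moments to a grid *)

Section cells.
Variables (n K : nat) (eta : R).

Definition moment_index := {a : d.-tuple 'I_n.+1 | (\sum_(i <- a) i <= n)%N}.

(** Adding [d^n] makes the moment of a bounded mixture nonnegative before it is rounded down to the
    mesh [eta]. The default of [inord] does not interfere once [K] is at least [2 d^n / eta]. *)
Definition moment_cell mus : {ffun moment_index -> 'I_K.+1} :=
  [ffun a : moment_index =>
    (inord (Num.truncn ((moment mus (tnth (val a)) + d%:R ^+ n) / eta))
      : 'I_K.+1)].

(** Stars and bars counts the multi-indices of degree at most [n]. *)
Lemma card_moment_cell :
  #|{ffun moment_index -> 'I_K.+1}| = (K.+1 ^ 'C(d + n, d))%N.
Proof.
rewrite card_ffun card_ord card_sig -card_partial_ord_partitions.
by congr (_ ^ _)%N; apply: eq_card => a; rewrite !inE.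
Qed.

Lemma moment_cell_dist mus nus (a : d.-tuple 'I_n.+1) :
  (0 < d)%N -> 0 < eta -> 2 * d%:R ^+ n / eta <= K%:R ->
  mean_bounded (Num.sqrt d%:R) mus -> mean_bounded (Num.sqrt d%:R) nus ->
  moment_cell mus = moment_cell nus -> (\sum_(i <- a) i <= n)%N ->
  `|moment mus (tnth a) - moment nus (tnth a)| <= eta.
Proof.
move=> d0 e0 hK bm bn /ffunP cE an.
have := cE (exist _ a an); rewrite !ffunE /= => /(congr1 (@nat_of_ord _)).
have := moment_le d0 bm an; have := moment_le d0 bn an.
set u := moment mus _; set v := moment nus _; set D := d%:R ^+ n in hK *.
rewrite !ler_norml => /andP[v1 v2] /andP[u1 u2].
(* Both truncations are at most [K], so [inord] keeps them and equal cells force equal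
   truncations. *)
have bound w : 0 <= w + D -> w <= D -> (Num.truncn ((w + D) / eta) < K.+1)%N.
  move=> w0 wD; rewrite ltnS truncn_le_nat; apply: (@le_lt_trans _ _ K%:R).
    by apply: le_trans hK; rewrite ler_pM2r ?invr_gt0 //; lra.
  by rewrite ltr_nat.
have u0 : 0 <= u + D by lra.
have v0 : 0 <= v + D by lra.
rewrite !inordK ?bound // => tE.
have /andP[a1 a2] := truncn_itv (divr_ge0 u0 (ltW e0)).
have /andP[b1 b2] := truncn_itv (divr_ge0 v0 (ltW e0)).
rewrite tE in a1 a2; move: a1 a2 b1 b2.
rewrite -natr1; set m := _%:R.
rewrite !ler_pdivlMr // !ltr_pdivrMr // => a1 a2 b1 b2.
by apply/andP; split; nra.
Qed.

End cells.

(** Sharing a cell makes the moments [eta]-close, which bounds the densities pointwise and then in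
    L1. The parameters stay free until the final choice. *)
Lemma close_mixtures_event (n K : nat) (eta s r p : R) :
  (0 < d)%N -> 0 < eta -> 2 * d%:R ^+ n / eta <= K%:R -> 1 <= s -> 0 <= p ->
  (forall x, uniform_euclid_ball d (Num.sqrt d%:R) (near_set r x) <= p%:E)%E ->
  exists E : set (k.-tuple Rd), [/\ measurable E,
    ((1 - ((k ^ 2)%:R * p + (K.+1 ^ 'C(d + n, d))%:R * (k`!%:R * p ^+ k)))%:E <=
      random_means d k (Num.sqrt d%:R) E)%E &
    forall mus, E mus -> exists nus, [/\
      mean_bounded (Num.sqrt d%:R) mus /\ mean_bounded (Num.sqrt d%:R) nus,
      well_separated r mus /\ well_separated r nus,
      ('N[lebesgue_Rn R d]_1
        [ (fun x => (mixture_pdf mus x - mixture_pdf nus x)%:E) ] <=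
        ((eta * expR (2 * pi * d%:R) +
          2 * (s ^- n * expR (2 * pi * s ^+ 2 * d%:R))) *
          Num.sqrt 2 ^+ d)%:E)%E &
      r <= param_dist mus nus]].
Proof.
move=> d0 e0 hK s1 p0 hp.
have rd : 0 < Num.sqrt d%:R :> R by rewrite sqrtr_gt0 ltr0n.
have [E [mE PE HE]] := pigeonhole_event (@moment_cell n K eta)
  (measurable_euclid_ball (n := d) (Num.sqrt d%:R)) (uniform_ballC d rd) p0 hp.
exists E; split => //; first by rewrite -card_moment_cell.
move=> mus /HE[nus [[bm bn] [sm sn] cE fa]]; exists nus; split => //.
- apply: mixture_L1_le.
    rewrite addr_ge0 ?mulr_ge0 ?expR_ge0 ?(ltW e0) // invr_ge0 exprn_ge0 //.
    exact: le_trans s1.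
  move=> x; apply: mixture_pdf_dist => // a an.
  exact: moment_cell_dist cE an.
- exact: param_dist_ge.
Qed.

End event.

(** * Choice of parameters *)

Section parameters.
Variable R : realType.
Implicit Types (l L p : R) (d k n : nat).

Lemma pi_le4 : pi <= 4 :> R.
Proof.
have /andP[_ h] := pihalf_02 R; lra.
Qed.

Lemma two_le_expR1 : 2 <= expR 1 :> R.
Proof. by have := expR_ge1Dx (1 : R); lra. Qed.

Lemma natr_le_expR n : n%:R <= expR n%:R :> R.
Proof. by have := expR_ge1Dx (n%:R : R); lra. Qed.

Lemma ffact_le_expn d m : (d ^_ m <= d ^ m)%N.
Proof.
elim: m => [|m IHm]; first by rewrite ffactn0.
by rewrite ffactnSr expnSr leq_mul // leq_subr.
Qed.

(* Take s ^+ 2 = r ^+ 2 / d, which minimizes the bound of lebesgue_near_set_le. *)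
Lemma uniform_near_set_expR l L d (x : d.-tuple (measurableTypeR R)) :
  100 <= l -> (0 < d)%N -> 0 < L -> L <= 6 * l * d%:R ->
  (uniform_euclid_ball d (Num.sqrt d%:R)
    (near_set (expR (- (24 * l)) * Num.sqrt L) x) <=
    (expR (- (18 * l * d%:R)))%:E)%E.
Proof.
move=> l100 d0 L0 Ld; set r := _ * _.
have dR : 0 < d%:R :> R by rewrite ltr0n.
have r0 : 0 < r by rewrite mulr_gt0 ?expR_gt0 // sqrtr_gt0.
pose s := r / Num.sqrt d%:R.
have s0 : 0 < s by rewrite divr_gt0 // sqrtr_gt0.
have p0 := pi_gt0 R.
apply: le_trans (uniform_near_set_le x d0 (ltW r0) s0) _; rewrite lee_fin.
have s2 : s ^+ 2 = r ^+ 2 / d%:R by rewrite expr_div_n sqr_sqrtr // ltW.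
(* The exponent becomes [d / 2], so both sides are [d]-th powers and only the bases have to be
   compared. *)
have -> : r ^+ 2 / (s ^+ 2 *+ 2) = 1 / 2 * d%:R.
  by rewrite -[s ^+ 2 *+ 2]mulr_natr s2; field; rewrite !gt_eqF.
rewrite expRM_natr -exprVn -exprMn -expr_div_n.
rewrite (_ : - (18 * l * d%:R) = - (18 * l) * d%:R); last by rewrite mulNr.
rewrite expRM_natr.
have b0 : 0 <= (normal_peak s)^-1 * expR (1 / 2) / 2.
  by rewrite !mulr_ge0 ?expR_ge0 // invr_ge0 normal_peak_ge0.
rewrite lerXn2r ?nnegrE ?expR_ge0 //.
(* Squaring removes the roots. With [C = expR l], the squared base is [pi / 2 * (L / d) * e * C^-48]
   and the target is [C^-36]; the first three factors together are at most [C^4]. *)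
rewrite -(@ler_pXn2r _ 2) ?nnegrE ?expR_ge0 //.
rewrite !exprMn /normal_peak invrK sqr_sqrtr; last first.
  by rewrite mulrn_wge0 // mulr_ge0 ?sqr_ge0 // ltW.
rewrite s2 exprMn sqr_sqrtr ?(ltW L0) // -!expRM_natl.
have Ldl : L / d%:R <= 6 * l by rewrite ler_pdivrMr.
have Ldl0 : 0 <= L / d%:R by rewrite divr_ge0 // ltW.
have -> : expR (2 * - (24 * l)) * L / d%:R * pi *+ 2 *
    expR (2 * (1 / 2)) * 2^-1 ^+ 2
  = (pi / 2) * (L / d%:R) * expR 1 * expR (2 * - (24 * l)).
  by rewrite (_ : 2 * (1 / 2) = 1); [field; rewrite gt_eqF | field].
have h1 : pi / 2 <= expR l by have := pi_le4; have := expR_ge1Dx l; lra.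
have h2 : 6 * l <= expR l * expR l.
  by have := expR_ge1Dx l; nra.
have h3 : expR 1 <= expR l by rewrite ler_expR; lra.
apply: (@le_trans _ _
    (expR l * (expR l * expR l) * expR l * expR (2 * - (24 * l)))).
  rewrite ler_wpM2r ?expR_ge0 // ler_pM ?expR_ge0 //.
    by rewrite mulr_ge0 // divr_ge0 // ltW.
  by rewrite ler_pM // ?divr_ge0 ?(ltW p0) // (le_trans Ldl).
by rewrite -!expRD ler_expR; lra.
Qed.

(** Each of the two terms is at most half of the target. In the first, [expR (- l d)] absorbs the
    factors exponential in [d]. In the second, [s = sqrt C] gives [s^-n <= expR (- 8 l C d)], while
    [C L <= 6 l C d]; the remaining [2 l C d] absorbs [2 pi C d + d] and the constants. *)
Lemma L1_bound_expR l L (C : R) d n : 100 <= l -> (0 < d)%N -> C = expR l ->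
  L <= 6 * l * d%:R -> 16 * C * d%:R <= n%:R ->
  (expR (- (C * L) - l * d%:R) * expR (2 * pi * d%:R) +
    2 * (expR (l / 2) ^- n * expR (2 * pi * expR (l / 2) ^+ 2 * d%:R))) *
    Num.sqrt 2 ^+ d <= expR (- (C * L)).
Proof.
move=> l100 d0 CE Ld nd.
have dR : 1 <= d%:R :> R by rewrite ler1n.
have C1 : 1 <= C by rewrite CE; have := expR_ge1Dx l; lra.
have p4 := pi_le4; have p0 := pi_gt0 R.
have sq2 : Num.sqrt 2 ^+ d <= expR (d%:R : R).
  rewrite (_ : expR _ = expR 1 ^+ d); last by rewrite -expRM_natl mulr1.
  rewrite lerXn2r ?nnegrE ?sqrtr_ge0 ?expR_ge0 //.
  apply: le_trans two_le_expR1.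
  rewrite -(@ler_pXn2r _ 2) ?nnegrE ?sqrtr_ge0 // sqr_sqrtr //.
  lra.
have -> : expR (l / 2) ^+ 2 = C by rewrite -expRM_natr CE; congr expR; field.
have -> : expR (l / 2) ^- n = expR (- (l / 2 * n%:R)).
  by rewrite expRN expRM_natr.
have q1 : 2 * pi * d%:R <= 8 * d%:R :> R by rewrite ler_wpM2r //; lra.
have q2 : 2 * pi * C * d%:R <= 8 * C * d%:R.
  by rewrite ler_wpM2r // ler_wpM2r //; lra.
have e2 := two_le_expR1.
apply: (le_trans (ler_wpM2l _ sq2)).
  by rewrite addr_ge0 ?mulr_ge0 ?expR_ge0.
rewrite mulrDl -!expRD -[2 * expR _ * _]mulrA -expRD.
have CL : C * L <= C * (6 * l * d%:R) by rewrite ler_wpM2l //; lra.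
have a1 : 2 * expR (- (C * L) - l * d%:R + 2 * pi * d%:R + d%:R) <=
    expR (- (C * L)).
  apply: le_trans (ler_wpM2r (expR_ge0 _) e2) _.
  by rewrite -expRD ler_expR; nra.
have ln : l * (16 * C * d%:R) <= l * n%:R by rewrite ler_wpM2l //; lra.
have Cd : 1 <= C * d%:R by nra.
have dCd : d%:R <= C * d%:R by nra.
have lCd : 100 * (C * d%:R) <= l * (C * d%:R) by nra.
have a2 : 2 * (2 * expR (- (l / 2 * n%:R) + 2 * pi * C * d%:R + d%:R)) <=
    expR (- (C * L)).
  apply: (@le_trans _ _ (expR 1 * (expR 1 *
    expR (- (l / 2 * n%:R) + 2 * pi * C * d%:R + d%:R)))).
    rewrite ler_pM ?mulr_ge0 ?expR_ge0 //.
    by rewrite ler_wpM2r ?expR_ge0.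
  by rewrite -!expRD ler_expR; lra.
lra.
Qed.

(** ['C(N, d) <= N^d / d!] with [N = (m + 1) d], and [d^d / d!] is a term of the series of
    [expR d]. *)
Lemma bin_le_expR d m : (0 < d)%N ->
  'C(d + m * d, d)%:R <= (m.+1%:R * expR 1) ^+ d :> R.
Proof.
move=> d0; rewrite exprMn -expRM_natl mulr1.
have fd : 0 < d`!%:R :> R by rewrite ltr0n fact_gt0.
rewrite -(ler_pM2r fd) -natrM bin_ffact -mulrA.
apply: (@le_trans _ _ ((d + m * d) ^ d)%:R).
  by rewrite ler_nat ffact_le_expn.
rewrite -mulSn expnMn natrM natrX ler_wpM2l ?exprn_ge0 //.
rewrite -ler_pdivrMr // natrX; case: d d0 fd => // d _ _.
by have := expR_ge1Dxn d (ler0n R d.+1); lra.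
Qed.

(** Let [M] be the binomial and [T] a bound on [ln (K + 1)]. Both are at most [C^(2 d)], so the
    logarithm of the count is at most [M T <= C^(4 d) <= k <= k L]. *)
Lemma cells_le_expR l L (C : R) d m K k : 100 <= l -> (1 < d)%N -> C = expR l ->
  4 * l * d%:R <= L -> L <= 6 * l * d%:R -> k%:R = expR L ->
  m%:R <= 16 * C + 1 ->
  K%:R <= 2 * d%:R ^+ (m * d) / expR (- (C * L) - l * d%:R) + 1 ->
  (K.+1 ^ 'C(d + m * d, d))%:R <= expR L ^+ k :> R.
Proof.
move=> l100 d1 CE dL Ld kE mC KC.
have d0 : (0 < d)%N by exact: ltnW.
have dR : 2 <= d%:R :> R by rewrite ler_nat.
have lC : l + 1 <= C by rewrite CE addrC expR_ge1Dx.
have e2 := two_le_expR1.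
(* The second summand comes from [d <= expR d]; the summand 2 absorbs constant factors through
   [2 <= expR 1]. *)
pose T := 2 + (m * d)%:R * d%:R + C * L + l * d%:R.
have L0 : 0 <= L by apply: le_trans dL; rewrite !mulr_ge0 //; lra.
have CL0 : 0 <= C * L by rewrite mulr_ge0 //; lra.
have md0 : 0 <= (m * d)%:R * d%:R :> R by rewrite mulr_ge0.
have ld0 : 0 <= l * d%:R by rewrite mulr_ge0 //; lra.
have KT : K.+1%:R <= expR T.
  have x1 : d%:R ^+ (m * d) / expR (- (C * L) - l * d%:R) <=
      expR ((m * d)%:R * d%:R + C * L + l * d%:R).
    rewrite -expRN opprD !opprK -addrA [leRHS]expRD ler_wpM2r ?expR_ge0 //.
    rewrite expRM_natl lerXn2r ?nnegrE ?expR_ge0 //; exact: natr_le_expR.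
  have x2 : 1 <= expR ((m * d)%:R * d%:R + C * L + l * d%:R).
    by rewrite -[leLHS]expR0 ler_expR; lra.
  rewrite -natr1.
  rewrite (_ : T = 1 + (1 + ((m * d)%:R * d%:R + C * L + l * d%:R)));
    last first.
    by rewrite /T; ring.
  rewrite 2!expRD; move: x1 x2 KC; rewrite -!mulrA.
  set u := _ * (expR _)^-1; set v := expR (_ + _ * L + _) => x1 x2 KC.
  apply: (@le_trans _ _ (2 * (2 * v))); first lra.
  by rewrite ler_pM // ?mulr_ge0 ?expR_ge0 // ler_wpM2r // expR_ge0.
(* Here [(m + 1) e <= (16 C + 2) e <= C^2], because [C / e >= 100]. *)
have M2 : 'C(d + m * d, d)%:R <= expR (2 * l * d%:R).
  apply: le_trans (bin_le_expR m d0) _.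
  rewrite expRM_natr lerXn2r ?nnegrE ?mulr_ge0 ?expR_ge0 //.
  have -> : expR (2 * l) = C * expR (l - 1) * expR 1.
    by rewrite CE -!expRD; congr expR; ring.
  rewrite -natr1 ler_wpM2r ?expR_ge0 //.
  have El : 100 <= expR (l - 1) by have := expR_ge1Dx (l - 1); lra.
  apply: (@le_trans _ _ (C * 100)); first lra.
  by rewrite ler_wpM2l //; lra.
have T0 : 0 <= T by rewrite /T; lra.
(* [T <= (19 + 7 l) C d^2 <= C^3 e^(2 d)], which is at most [C^(2 d)] because [d >= 2] and
   [l >= 100]. *)
have T2 : T <= expR (2 * l * d%:R).
  have y1 : (m * d)%:R * d%:R <= 17 * C * (d%:R * d%:R).
    rewrite natrM -mulrA ler_wpM2r ?mulr_ge0 //; lra.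
  have dd : d%:R <= d%:R * d%:R :> R by nra.
  have y2 : C * L <= 6 * l * C * (d%:R * d%:R).
    apply: (@le_trans _ _ (C * (6 * l * d%:R))).
      by rewrite ler_wpM2l //; lra.
    rewrite (_ : C * _ = 6 * l * C * d%:R); last by ring.
    by rewrite ler_wpM2l //; nra.
  have y3 : l * d%:R <= l * C * (d%:R * d%:R).
    rewrite -mulrA ler_wpM2l //; first lra.
    by apply: (le_trans dd); rewrite ler_peMl //; nra.
  have y4 : 2 <= 2 * C * (d%:R * d%:R) by nra.
  have y5 : T <= (19 + 7 * l) * (C * (d%:R * d%:R)).
    rewrite /T; lra.
  have y6 : 19 + 7 * l <= expR l * expR l by rewrite -CE; nra.
  apply: (le_trans y5).
  apply: (@le_trans _ _ (expR l * expR l * (expR l * (expR d%:R * expR d%:R)))).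
    rewrite CE ler_pM ?mulr_ge0 ?expR_ge0 //; first lra.
    by rewrite ler_wpM2l ?expR_ge0 // ler_pM // ?natr_le_expR.
  by rewrite -!expRD ler_expR; nra.
rewrite natrX; apply: (@le_trans _ _ (expR T ^+ 'C(d + m * d, d))).
  by rewrite lerXn2r ?nnegrE ?expR_ge0.
rewrite -!expRM_natl ler_expR kE.
have L1 : 1 <= L by nra.
apply: (@le_trans _ _ (expR (2 * l * d%:R) * expR (2 * l * d%:R))).
  by rewrite ler_pM.
rewrite -expRD; apply: (@le_trans _ _ (expR L)); first by rewrite ler_expR; lra.
by rewrite ler_peMr ?expR_ge0.
Qed.

(** Since [p <= k^-3] and [k! <= k^k], the two terms are at most [1 / k] and
    [k^k * k^k * k^(-3 k) = k^(-k) <= 1 / k]. *)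
Lemma failure_probability_le L k (N : nat) p : (0 < k)%N -> k%:R = expR L ->
  0 <= p -> p <= expR (- (3 * L)) -> N%:R <= expR L ^+ k ->
  (k ^ 2)%:R * p + N%:R * (k`!%:R * p ^+ k) <= 2 / k%:R :> R.
Proof.
move=> k0 kE p0 pL NL; have kR : 1 <= k%:R :> R by rewrite ler1n.
have L0 : 0 <= L by rewrite -(ler_expR 0) expR0 -kE.
have a1 : (k ^ 2)%:R * p <= k%:R^-1.
  rewrite natrX kE -expRN -expRM_natl.
  apply: le_trans (ler_wpM2l (expR_ge0 _) pL) _.
  by rewrite -expRD ler_expR; lra.
have fk : k`!%:R <= expR L ^+ k :> R.
  by rewrite -kE -natrX ler_nat -ffactnn ffact_le_expn.
have a2 : N%:R * (k`!%:R * p ^+ k) <= k%:R^-1.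
  apply: (@le_trans _ _ (expR L ^+ k * (expR L ^+ k * expR (- (3 * L)) ^+ k))).
    rewrite ler_pM ?mulr_ge0 ?exprn_ge0 // ler_pM ?exprn_ge0 //.
    by rewrite lerXn2r ?nnegrE ?expR_ge0.
  rewrite -!exprMn -!expRD -expRM_natl [in leRHS]kE -expRN ler_expR.
  rewrite (_ : L + (L - 3 * L) = - L); last by ring.
  by rewrite mulrN lerN2 ler_peMl.
rewrite (_ : 2 / k%:R = k%:R^-1 + k%:R^-1) ?lerD //.
by field; rewrite gt_eqF; lra.
Qed.

End parameters.

Theorem theorem3p1 (R : realType) :
  exists C0 : R, forall C : R, C0 <= C ->
  exists c c2 : R,
    [/\ 0 < c, 0 < c2, c = 1 / (4 * ln C), c2 = C ^- 24 &
    forall k : nat, C ^+ 8 <= k%:R ->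
    let d := Num.truncn (c * ln (k%:R : R)) in
    exists E : set (k.-tuple (d.-tuple (measurableTypeR R))),
    [/\ measurable E,
        ((1 - 2 / k%:R)%:E <= random_means d k (Num.sqrt d%:R) E)%E &
        forall mus, E mus ->
        exists mus' : k.-tuple (d.-tuple (measurableTypeR R)),
          [/\ mean_bounded (Num.sqrt d%:R) mus /\
              mean_bounded (Num.sqrt d%:R) mus',
              well_separated (c2 * Num.sqrt (ln k%:R)) mus /\
              well_separated (c2 * Num.sqrt (ln k%:R)) mus',
              ('N[lebesgue_Rn R d]_1
                 [ (fun x => (mixture_pdf mus x - mixture_pdf mus' x)%:E) ]
                 <= (k%:R `^ (- C))%:E)%E &
              c2 * Num.sqrt (ln k%:R) <= param_dist mus mus']]].
Proof.
(* A generous threshold: it gives [ln C >= 100], on which the numerical comparisons rest. *)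
exists (expR 100) => C C100.
have C0 : 0 < C by apply: lt_le_trans C100; exact: expR_gt0.
pose l := ln C; have CE : C = expR l by rewrite lnK.
have l100 : 100 <= l by rewrite -ler_expR -CE.
have c20 : C ^- 24 = expR (- (24 * l)) by rewrite CE expRN expRM_natl.
exists (1 / (4 * ln C)), (C ^- 24); split => //.
- by rewrite -/l divr_gt0 //; lra.
- by rewrite c20 expR_gt0.
move=> k kC d.
have k0 : 0 < k%:R :> R by apply: lt_le_trans kC; rewrite exprn_gt0.
pose L := ln (k%:R : R); have kE : k%:R = expR L by rewrite lnK.
have L8 : 8 * l <= L by rewrite -ler_expR -kE expRM_natl -CE.
(* The hypothesis [k >= C^8] gives [L / (4 l) >= 2], hence [d >= 2] after truncation. *)
have ratio2 : 2 <= 1 / (4 * l) * L.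
  by rewrite mulrAC ler_pdivlMr ?mul1r; lra.
have /andP[dl du] : d%:R <= 1 / (4 * l) * L < d.+1%:R.
  by apply: truncn_itv; exact: le_trans ratio2.
have d1 : (1 < d)%N by rewrite /d truncn_ge_nat // (le_trans _ ratio2).
have dR : 2 <= d%:R :> R by rewrite ler_nat.
have dL : 4 * l * d%:R <= L.
  by move: dl; rewrite mulrAC ler_pdivlMr ?mul1r ?[d%:R * _]mulrC //; lra.
(* Truncation gives [L < 4 l (d + 1)], and [d + 1 <= 3 d / 2] because [d >= 2]. *)
have Ld : L <= 6 * l * d%:R.
  move: du; rewrite mulrAC ltr_pdivrMr ?mul1r; last lra.
  by rewrite -natr1 => du; nra.
(* This turns the small-ball probability [C^(-18 d)] into [k^-3]. *)
have p3 : - (18 * l * d%:R) <= - (3 * L) by lra.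
have s1 : 1 <= expR (l / 2) by rewrite -[leLHS]expR0 ler_expR; lra.
have L0 : 0 < L by lra.
have d0 : (0 < d)%N by exact: ltnW.
(* The Taylor order is [n = m * d] with [m] just above [16 C]; a multiple of [d] suits the binomial
   bound. *)
pose m := (Num.truncn (16 * C)).+1.
have m1 : 16 * C <= m%:R by apply: ltW; exact: truncnS_gt.
have m2 : m%:R <= 16 * C + 1.
  by rewrite /m -natr1 lerD2r truncn_le mulr_ge0 // ltW.
(* The mesh is [k^-C * C^-d]; the factor [C^-d] pays for the losses exponential in [d] in the L1
   estimate. *)
pose eta := expR (- (C * L) - l * d%:R).
pose K := (Num.truncn (2 * d%:R ^+ (m * d) / eta)).+1.
have q0 : 0 <= 2 * d%:R ^+ (m * d) / eta.
  by rewrite divr_ge0 ?expR_ge0 // mulr_ge0 // exprn_ge0.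
have K1 : 2 * d%:R ^+ (m * d) / eta <= K%:R by apply: ltW; exact: truncnS_gt.
have K2 : K%:R <= 2 * d%:R ^+ (m * d) / eta + 1.
  by rewrite /K -natr1 lerD2r truncn_le.
have [E [mE PE HE]] := close_mixtures_event k d0 (expR_gt0 _) K1 s1 (expR_ge0 _)
  (fun x => uniform_near_set_expR x l100 d0 L0 Ld).
exists E; split => //.
  apply: le_trans PE; rewrite lee_fin lerD2l lerN2.
  apply: (@failure_probability_le _ L) => //.
  - by rewrite -(ltr0n R).
  - by rewrite ler_expR.
  - exact: (cells_le_expR l100 d1 CE dL Ld kE m2 K2).
move=> mus /HE[nus [bb ss close far]]; exists nus.
rewrite c20; split => //; apply: le_trans close _; rewrite lee_fin.
(* As [k] is nonzero, the power [k^-C] unfolds to [expR (- C * L)]. *)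
rewrite /powR gt_eqF // mulNr; apply: (L1_bound_expR l100 d0 CE Ld).
by rewrite natrM ler_wpM2r.
Qed.
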